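(* Let $S$ be the unilateral shift on $\ell^2$, $Se_n=e_{n+1}$ for $n\ge 0$, where $(e_n)_{n\ge 0}$ is the standard orthonormal basis. If $0<\lambda\le 1$, then $\lambda$ is an extended eigenvalue for $I-S^*$, and moreover the Euler operator $E_\lambda$ is a corresponding extended eigenoperator.
   Context: For $\lambda\in\mathbb C$ the Euler operator $E_\lambda$ is defined on $\ell^2$ by $(E_\lambda f)(n)=\sum_{k=0}^n\binom nk\lambda^k(1-\lambda)^{n-k}f(k)$, $n=0,1,2,\dots$. A complex scalar $\lambda$ is an extended eigenvalue of a bounded linear operator $T$ on a complex Hilbert (or Banach) space if there is a nonzero bounded linear operator $X$ with $TX=\lambda XT$; such an $X$ is called an extended eigenoperator of $T$ corresponding to $\lambda$. *)

(* Defs.v *)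
From HB Require Import structures.
From mathcomp Require Import all_boot all_order all_algebra.
From mathcomp Require Import all_classical all_reals all_analysis.
From mathcomp Require Import complex ring lra.
Import Order.TTheory GRing.Theory Num.Theory.
Import numFieldNormedType.Exports.

Set Implicit Arguments.
Unset Strict Implicit.
Unset Printing Implicit Defensive.

Local Open Scope classical_set_scope.
Local Open Scope ring_scope.
Local Open Scope complex_scope.

Section Operators.
Variables (R : realType) (V : normedModType R[i]).
Implicit Types T X : V -> V.

Definition bounded_linear T :=
  linear T /\ exists M : R[i], forall x, `|T x| <= M * `|x|.

Definition extended_eigenoperator T (lambda : R[i]) X :=
  [/\ bounded_linear X, X <> (fun=> 0) & forall x, T (X x) = lambda *: X (T x)].

Definition extended_eigenvalue T (lambda : R[i]) :=
  bounded_linear T /\ exists X, extended_eigenoperator T lambda X.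

End Operators.

Section Ell2.
Variable R : realType.
Local Notation normc := (@Normc.normc R).

Definition square_series (f : nat -> R[i]) : R^nat :=
  series (fun n => normc (f n) ^+ 2).

Definition square_summable : {pred nat -> R[i]} :=
  [pred f | `[< cvgn (square_series f) >]].

Record ell2 : Type := Ell2 {
  ell2_seq :> nat -> R[i];
  ell2P : ell2_seq \in square_summable }.

HB.instance Definition _ := [isSub for ell2_seq].
HB.instance Definition _ := [Choice of ell2 by <:].

Lemma square_summableP f :
  reflect (cvgn (square_series f)) (f \in square_summable).
Proof. exact: asboolP. Qed.

Lemma nd_square_series f : nondecreasing_seq (square_series f).
Proof.
by apply/nondecreasing_seqP => n; rewrite /square_series seriesSr lerDl sqr_ge0.
Qed.

Lemma square_summable_bound f (M : R) :
  (forall n, square_series f n <= M) -> f \in square_summable.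
Proof.
move=> fM; apply/square_summableP.
apply: nondecreasing_is_cvgn; first exact: nd_square_series.
by exists M => _ [n _ <-].
Qed.

Lemma square_series_le_lim f n :
  f \in square_summable -> square_series f n <= limn (square_series f).
Proof.
move=> /square_summableP cf.
by apply: nondecreasing_cvgn_le => //; exact: nd_square_series.
Qed.

Lemma sqr_normcZ (a z : R[i]) : normc (a * z) ^+ 2 = normc a ^+ 2 * normc z ^+ 2.
Proof. by rewrite Normc.normcM exprMn. Qed.

Lemma normc_ge0 (z : R[i]) : 0 <= normc z.
Proof. by case: z => a b /=; exact: sqrtr_ge0. Qed.

Lemma normr_normc (z : R[i]) : `|z| = (normc z)%:C.
Proof. by case: z. Qed.

Lemma normcD_le (z w : R[i]) : normc (z + w) <= normc z + normc w.
Proof. exact: le_normcD. Qed.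

Lemma square_seriesZ a f :
  square_series (a *: f) = (normc a ^+ 2) *: square_series f.
Proof.
rewrite /square_series -seriesZ; congr series.
by apply/funext => n /=; exact: sqr_normcZ.
Qed.

Lemma square_summable_closed : submod_closed square_summable.
Proof.
split.
  apply: (@square_summable_bound _ 0) => n.
  rewrite /square_series /series /= big1 // => k _.
  by change (normc (0 : R[i]) ^+ 2 = 0); rewrite Normc.normc0 expr0n.
move=> a f g hf hg.
pose F := limn (square_series (a *: f)).
pose G := limn (square_series g).
have haf : a *: f \in square_summable.
  apply/square_summableP; rewrite square_seriesZ.
  apply: is_cvgZl_tmp; exact/square_summableP.
apply: (@square_summable_bound _ (2 * F + 2 * G)) => n.
have hF := square_series_le_lim n haf.
have hG := square_series_le_lim n hg.
apply: (@le_trans _ _ (2 * square_series (a *: f) n + 2 * square_series g n)).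
  rewrite /square_series /series /= !mulr_sumr -big_split /=.
  apply: ler_sum => k _.
  have /= h := normcD_le ((a *: f) k) (g k).
  have h0 := normc_ge0 ((a *: f) k + g k).
  have h1 := normc_ge0 ((a *: f) k).
  have h2 := normc_ge0 (g k).
  change (normc ((a *: f) k + g k) ^+ 2 <=
    2 * normc ((a *: f) k) ^+ 2 + 2 * normc (g k) ^+ 2).
  apply: (@le_trans _ _ ((normc ((a *: f) k) + normc (g k)) ^+ 2)).
    by rewrite ler_pXn2r// nnegrE addr_ge0.
  have := sqr_ge0 (normc ((a *: f) k) - normc (g k)).
  lra.
by rewrite lerD// ler_pM2l.
Qed.

HB.instance Definition _ :=
  GRing.isSubmodClosed.Build _ _ square_summable square_summable_closed.
HB.instance Definition _ := [SubChoice_isSubLmodule of ell2 by <:].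

Implicit Types f g : ell2.

Lemma ell2DE f g n : (f + g) n = f n + g n. Proof. by []. Qed.
Lemma ell2ZE a f n : (a *: f) n = a * f n. Proof. by []. Qed.
Lemma ell2NE f n : (- f) n = - f n. Proof. by []. Qed.
Lemma ell20E n : (0 : ell2) n = 0. Proof. by []. Qed.

Lemma ell2_eq f g : f =1 g -> f = g.
Proof. by move=> fg; apply: val_inj; exact/funext. Qed.

Definition ell2_rnorm f : R := Num.sqrt (limn (square_series f)).

Lemma ell2_rnorm_ge0 f : 0 <= ell2_rnorm f. Proof. exact: sqrtr_ge0. Qed.

Lemma square_series_le f n : square_series f n <= ell2_rnorm f ^+ 2.
Proof.
have h m : square_series f m <= limn (square_series f).
  exact: square_series_le_lim (ell2P f).
by rewrite sqr_sqrtr//; apply: le_trans (h 0%N); rewrite /square_series /series /= big_geq.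
Qed.

Lemma ell2_rnorm_le f (M : R) :
  0 <= M -> (forall n, square_series f n <= M ^+ 2) -> ell2_rnorm f <= M.
Proof.
move=> M0 h; rewrite -(ler_pXn2r (ltn0Sn 1)) ?nnegrE ?ell2_rnorm_ge0//.
rewrite sqr_sqrtr; last first.
  apply: le_trans (square_series_le_lim 0 (ell2P f)).
  by rewrite /square_series /series /= big_geq.
apply: limr_le; first exact/square_summableP/ell2P.
by near=> n; exact: h.
Unshelve. all: by end_near. Qed.

Lemma normc_le_ell2_rnorm f n : normc (f n) <= ell2_rnorm f.
Proof.
rewrite -(ler_pXn2r (ltn0Sn 1)) ?nnegrE ?ell2_rnorm_ge0 ?normc_ge0//.
apply: le_trans (square_series_le f n.+1).
rewrite /square_series seriesSr lerDr.
by rewrite /series /=; apply: sumr_ge0 => k _; exact: sqr_ge0.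
Qed.

Lemma ell2_rnorm0_eq0 f : ell2_rnorm f = 0 -> f = 0.
Proof.
move=> f0; apply: ell2_eq => n; apply: Normc.eq0_normc; apply/eqP.
by rewrite eq_le normc_ge0 andbT -f0 normc_le_ell2_rnorm.
Qed.

Lemma ell2_rnormZ a f : ell2_rnorm (a *: f) = normc a * ell2_rnorm f.
Proof.
rewrite /ell2_rnorm.
have -> : square_series (a *: f) = normc a ^+ 2 *: square_series f.
  exact: square_seriesZ.
rewrite limZl_tmp; last exact/square_summableP/ell2P.
by rewrite sqrtrM ?sqr_ge0// sqrtr_sqr ger0_norm// normc_ge0.
Qed.

Lemma ell2_rnormD f g : ell2_rnorm (f + g) <= ell2_rnorm f + ell2_rnorm g.
Proof.
have [->|f0] := eqVneq f 0.
  by rewrite add0r lerDr ell2_rnorm_ge0.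
have [->|g0] := eqVneq g 0.
  by rewrite addr0 lerDl ell2_rnorm_ge0.
set A := ell2_rnorm f; set B := ell2_rnorm g.
have A0 : 0 < A.
  rewrite lt_neqAle ell2_rnorm_ge0 andbT eq_sym.
  by apply: contra_neq f0; exact: ell2_rnorm0_eq0.
have B0 : 0 < B.
  rewrite lt_neqAle ell2_rnorm_ge0 andbT eq_sym.
  by apply: contra_neq g0; exact: ell2_rnorm0_eq0.
apply: ell2_rnorm_le => [|n]; first by rewrite addr_ge0 ?ltW.
rewrite -(ler_pM2l (mulr_gt0 A0 B0)).
have hF : square_series f n <= A ^+ 2 := square_series_le f n.
have hG : square_series g n <= B ^+ 2 := square_series_le g n.
apply: (@le_trans _ _ ((A + B) * (B * square_series f n + A * square_series g n))).
  rewrite /square_series /series /= !mulr_sumr -big_split /= mulr_sumr.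
  apply: ler_sum => k _.
  change (A * B * normc (f k + g k) ^+ 2 <=
    (A + B) * (B * normc (f k) ^+ 2 + A * normc (g k) ^+ 2)).
  have h := normcD_le (f k) (g k).
  apply: (@le_trans _ _ (A * B * (normc (f k) + normc (g k)) ^+ 2)).
    rewrite ler_pM2l ?mulr_gt0// ler_pXn2r// nnegrE ?normc_ge0//.
    by rewrite addr_ge0 ?normc_ge0.
  have := sqr_ge0 (B * normc (f k) - A * normc (g k)).
  lra.
have -> : A * B * (A + B) ^+ 2 = (A + B) * (B * A ^+ 2 + A * B ^+ 2) by ring.
by rewrite ler_pM2l ?addr_gt0// lerD// ler_pM2l.
Qed.

Definition ell2_norm f : R[i] := (ell2_rnorm f)%:C.

Lemma ell2_normD f g : ell2_norm (f + g) <= ell2_norm f + ell2_norm g.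
Proof. by rewrite /ell2_norm -rmorphD lecR ell2_rnormD. Qed.

Lemma ell2_normZ (a : R[i]) f : ell2_norm (a *: f) = `|a| * ell2_norm f.
Proof. by rewrite /ell2_norm ell2_rnormZ rmorphM normr_normc. Qed.

Lemma ell2_norm0_eq0 f : ell2_norm f = 0 -> f = 0.
Proof. by case=> /ell2_rnorm0_eq0. Qed.

HB.instance Definition _ :=
  Lmodule_isNormed.Build R[i] ell2 ell2_normD ell2_normZ ell2_norm0_eq0.

Lemma ell2_normE f : `|f| = (ell2_rnorm f)%:C. Proof. by []. Qed.

(* [R[i]] carries its topology, hence limits, through the alias [R[i]^o]. *)
Definition ell2_inner f g : R[i] :=
  limn (series (fun n => f n * Num.conj (g n)) : nat -> R[i]^o).

Lemma cvg_real_complex (u : R^nat) (l : R) :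
  u @ \oo --> l -> (fun n => (u n)%:C : R[i]^o) @ \oo --> (l%:C : R[i]^o).
Proof.
move=> ul; apply/cvgrPdist_lt => e e0; move/cvgrPdist_lt : ul.
have -> : e = (complex.Re e)%:C.
  by case: e e0 => a b /=; rewrite ltcE /= => /andP[/eqP -> _].
have re0 : 0 < complex.Re e by move: e0; rewrite ltcE => /andP[].
move=> /(_ _ re0) ul; near=> n.
have : `|l - u n| < complex.Re e by near: n; exact: ul.
rewrite -[l%:C - _]/(l%:C - (u n)%:C : R[i]) -rmorphB.
by rewrite normr_normc ltcR /= expr0n addr0 sqrtr_sqr.
Unshelve. all: by end_near. Qed.

Lemma is_cvg_complex (v : nat -> R[i]) :
  cvgn (fun n => complex.Re (v n)) -> cvgn (fun n => complex.Im (v n)) ->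
  cvgn (v : nat -> R[i]^o).
Proof.
move=> /cvg_real_complex hr /cvg_real_complex hi; have -> : (v : nat -> R[i]^o) =
    (fun n => (complex.Re (v n))%:C + 'i *: ((complex.Im (v n))%:C : R[i]^o)).
  by apply/funext => n; rewrite [LHS]complexE.
apply/cvg_ex; eexists; apply: cvgD; first exact: hr.
by apply: cvgZl_tmp; exact: hi.
Qed.

Lemma is_cvg_ell2_inner f g :
  cvgn (series (fun n => f n * Num.conj (g n)) : nat -> R[i]^o).
Proof.
pose b n := normc (f n) ^+ 2 + normc (g n) ^+ 2.
have cb : cvgn (series b).
  have -> : b = (fun n => normc (f n) ^+ 2) + (fun n => normc (g n) ^+ 2) by [].
  by apply: is_cvg_seriesD; exact/square_summableP/ell2P.
have main (p : {additive R[i] -> R}) :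
    (forall z, `|p z| <= normc z) ->
    cvgn (fun n => p (series (fun n => f n * Num.conj (g n)) n)).
  move=> hp.
  have -> : (fun n => p (series (fun n => f n * Num.conj (g n)) n)) =
      series (fun n => p (f n * Num.conj (g n))).
    by apply/funext => n; rewrite /series /= raddf_sum.
  apply: normed_cvg; apply: (series_le_cvg _ _ _ cb) => n /=.
  - exact: normr_ge0.
  - by rewrite /b addr_ge0 ?sqr_ge0.
  apply: le_trans (hp _) _.
  have -> : normc (f n * Num.conj (g n)) = normc (f n) * normc (g n).
    rewrite Normc.normcM; congr (_ * _).
    by case: (g n) => x y /=; rewrite sqrrN.
  rewrite /b; have := sqr_ge0 (normc (f n) - normc (g n)).
  have := mulr_ge0 (normc_ge0 (f n)) (normc_ge0 (g n)).
  lra.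
apply: is_cvg_complex.
- apply: (main (@complex.Re R)) => -[x y] /=.
  by rewrite -sqrtr_sqr ler_wsqrtr// lerDl sqr_ge0.
- apply: (main (@complex.Im R)) => -[x y] /=.
  by rewrite -sqrtr_sqr ler_wsqrtr// lerDr sqr_ge0.
Qed.

Lemma inner_norm f : ell2_inner f f = `|f| ^+ 2.
Proof.
rewrite ell2_normE -rmorphXn sqr_sqrtr; last first.
  by apply: le_trans (square_series_le_lim 0 (ell2P f));
     rewrite /square_series /series /= big_geq.
apply: (@cvg_lim R[i]^o); first exact: norm_hausdorff.
have /cvg_real_complex : square_series f @ \oo --> limn (square_series f).
  exact/square_summableP/ell2P.
suff -> : (fun n => (square_series f n)%:C : R[i]^o) =
    (series (fun n => f n * Num.conj (f n)) : nat -> R[i]^o) by [].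
apply/funext => n.
rewrite /square_series /series /= rmorph_sum; apply: eq_bigr => k _.
by rewrite -normCK normr_normc -rmorphXn.
Qed.

(* This relation determines the adjoint (see [adjoint_unique]); [adjoint T] is
   the zero map when there is none. *)
Definition is_adjoint (T T' : ell2 -> ell2) :=
  forall f g, ell2_inner (T f) g = ell2_inner f (T' g).

Definition adjoint (T : ell2 -> ell2) : ell2 -> ell2 :=
  xget (fun=> 0) (is_adjoint T).

Lemma square_series_shift (u : nat -> R[i]) n :
  square_series u n.+1 = normc (u 0%N) ^+ 2 + square_series (u \o S) n.
Proof. by rewrite /square_series /series /= big_nat_recl. Qed.

Definition basis_seq m : nat -> R[i] := fun n => (n == m)%:R.

Lemma basis_subproof m : basis_seq m \in square_summable.
Proof.
apply: (@square_summable_bound _ 1) => n.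
suff -> : square_series (basis_seq m) n = (m < n)%N%:R.
  by rewrite -[leRHS]/(1%N%:R) ler_nat leq_b1.
elim: n => [|n IHn]; first by rewrite /square_series /series /= big_geq.
rewrite /square_series seriesSr -/(square_series _) IHn /basis_seq ltnS.
case: ltngtP => _.
- by rewrite Normc.normc0 expr0n addr0.
- by rewrite Normc.normc0 expr0n addr0.
- by rewrite -[true%:R]/(1 : R[i]) Normc.normc1 expr1n add0r.
Qed.

Definition ell2_basis m : ell2 := Ell2 (basis_subproof m).

Definition shift_seq (f : nat -> R[i]) : nat -> R[i] :=
  fun n => if n is m.+1 then f m else 0.

Lemma shift_subproof f : shift_seq f \in square_summable.
Proof.
apply: (@square_summable_bound _ (ell2_rnorm f ^+ 2)) => n.
apply: le_trans (nd_square_series _ (leqnSn n)) _.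
rewrite square_series_shift Normc.normc0 expr0n add0r.
exact: square_series_le.
Qed.

Definition unilateral_shift f : ell2 := Ell2 (shift_subproof f).

Lemma shift_basis m : unilateral_shift (ell2_basis m) = ell2_basis m.+1.
Proof. by apply: ell2_eq => -[|n]. Qed.

Lemma bshift_subproof f : (fun n => f n.+1) \in square_summable.
Proof.
apply: (@square_summable_bound _ (ell2_rnorm f ^+ 2)) => n.
apply: le_trans (square_series_le f n.+1).
by rewrite square_series_shift lerDr sqr_ge0.
Qed.

Definition backward_shift f : ell2 := Ell2 (bshift_subproof f).

Lemma shift_bshift_adjoint : is_adjoint unilateral_shift backward_shift.
Proof.
move=> f g; apply: (@cvg_lim R[i]^o); first exact: norm_hausdorff.
rewrite -cvg_shiftS.
rewrite (_ : [sequence _ n.+1]_n =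
    series (fun n => f n * Num.conj (backward_shift g n))); last first.
  by apply/funext => n; rewrite /series /= big_nat_recl// mul0r add0r.
exact: (@is_cvg_ell2_inner f (backward_shift g)).
Qed.

Lemma inner_basis m g : ell2_inner (ell2_basis m) g = Num.conj (g m).
Proof.
apply: (@cvg_lim R[i]^o); first exact: norm_hausdorff.
apply: cvg_near_cst; exists m.+1 => // n /= mn.
rewrite /series /= (bigD1_seq m) ?mem_index_iota ?iota_uniq//=.
rewrite /basis_seq eqxx mul1r big1 ?addr0// => k /negPf ->.
by rewrite mul0r.
Qed.

Lemma adjoint_unique T T1 T2 : is_adjoint T T1 -> is_adjoint T T2 -> T1 = T2.
Proof.
move=> h1 h2; apply/funext => g; apply: ell2_eq => m.
by apply: (can_inj (@conjCK _)); rewrite -!inner_basis -h1 -h2.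
Qed.

Lemma adjoint_shift : adjoint unilateral_shift = backward_shift.
Proof.
rewrite /adjoint; case: xgetP => [T _ hT|/(_ backward_shift)/(_ shift_bshift_adjoint)//].
exact: adjoint_unique hT shift_bshift_adjoint.
Qed.

End Ell2.

Definition euler (R : realType) (lambda : R[i]) (f : nat -> R[i]) (n : nat) : R[i] :=
  \sum_(k < n.+1) 'C(n, k)%:R * lambda ^+ k * (1 - lambda) ^+ (n - k) * f k.

(* Main.v *)
(** The coefficients [w n k = 'C(n, k) * l ^+ k * (1 - l) ^+ (n - k)] of the
    Euler operator are the binomial probabilities, so that, by convexity of the
    square, [|E f n|^2 <= \sum_k w n k * |f k|^2].  Pascal's rule
    [w n.+1 k.+1 = (1 - l) * w n k.+1 + l * w n k] shows that the column sums
    [\sum_n w n k] do not increase with [k]; the one for [k = 0] is geometric,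
    hence all are at most [l^-1] and [E] is bounded by [l ^ (- 1 / 2)].  Splitting
    [E f n.+1] by Pascal's rule also gives the intertwining relation. *)
Require Import Defs.
From mathcomp Require Import all_boot all_order all_algebra.
From mathcomp Require Import all_classical all_reals all_analysis.
From mathcomp Require Import complex ring lra.
Import Order.TTheory GRing.Theory Num.Theory.
Import numFieldNormedType.Exports.
Local Open Scope ring_scope.
Local Open Scope complex_scope.

(** * Binomial weights and convexity *)

Definition binomial_weight {K : comNzRingType} (l : K) (n k : nat) : K :=
  'C(n, k)%:R * l ^+ k * (1 - l) ^+ (n - k).

Lemma binomial_weight_small {K : comNzRingType} (l : K) n k :
  (n < k)%N -> binomial_weight l n k = 0.
Proof. by move=> nk; rewrite /binomial_weight bin_small// !mul0r. Qed.

Lemma binomial_weight0 {K : comNzRingType} (l : K) n :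
  binomial_weight l n 0 = (1 - l) ^+ n.
Proof. by rewrite /binomial_weight bin0 subn0 !mul1r. Qed.

Lemma binomial_weightS {K : comNzRingType} (l : K) n k :
  binomial_weight l n.+1 k.+1 =
  (1 - l) * binomial_weight l n k.+1 + l * binomial_weight l n k.
Proof.
rewrite /binomial_weight binS natrD subSS.
(* For [n <= k] the truncated exponent [n - k.+1] is harmless, since its coefficient ['C(n, k.+1)]
   vanishes. *)
have [kn|nk] := ltnP k n; last by rewrite bin_small// exprS; ring.
by rewrite -(subnSK kn) !exprS; ring.
Qed.

Lemma sum_binomial_weight {K : comNzRingType} (l : K) n :
  \sum_(k < n.+1) binomial_weight l n k = 1.
Proof.
rewrite -[RHS](expr1n K n) -[X in X ^+ n](subrK l 1) exprDn.
by apply: eq_bigr => k _; rewrite /binomial_weight -mulr_natl; ring.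
Qed.

Lemma sum_binomial_weightS {K : comNzRingType} (l : K) (f : nat -> K) n :
  \sum_(k < n.+2) binomial_weight l n.+1 k * f k =
  \sum_(k < n.+1) binomial_weight l n k * ((1 - l) * f k + l * f k.+1).
Proof.
rewrite big_ord_recl /= binomial_weight0.
under eq_bigr => k _.
  rewrite /bump /= add1n binomial_weightS mulrDl.
  over.
rewrite big_split /= addrA.
under [RHS]eq_bigr => k _ do rewrite mulrDr.
rewrite [RHS]big_split /=; congr (_ + _); last by apply: eq_bigr => k _; ring.
(* The top weight [w n n.+1] is zero; the split-off term [w n.+1 0 = (1 - l) * w n 0] fills the
   missing place at [k = 0]. *)
rewrite big_ord_recr /= binomial_weight_small// mulr0 mul0r addr0.
rewrite [RHS]big_ord_recl /= binomial_weight0 exprS; congr (_ + _); first by ring.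
by apply: eq_bigr => k _; rewrite /bump /= add1n; ring.
Qed.

(** The difference of the two sides is the variance of [a] under the weights [w], a sum of
    nonnegative terms. *)
Lemma sqr_convex_sum {F : realFieldType} n (w a : 'I_n -> F) :
    (forall i, 0 <= w i) -> \sum_i w i = 1 ->
  (\sum_i w i * a i) ^+ 2 <= \sum_i w i * a i ^+ 2.
Proof.
move=> w0 w1.
have variance m : \sum_i w i * (a i - m) ^+ 2 =
    \sum_i w i * a i ^+ 2 + (- 2 * m) * \sum_i w i * a i + m ^+ 2 * \sum_i w i.
  rewrite !mulr_sumr -!big_split /=.
  by apply: eq_bigr => i _; ring.
have : 0 <= \sum_i w i * (a i - \sum_j w j * a j) ^+ 2.
  by apply: sumr_ge0 => i _; rewrite mulr_ge0 ?sqr_ge0.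
by rewrite variance w1; lra.
Qed.

(** * Column sums of the real weights *)

Section BinomialWeightReal.
Variables (F : realFieldType) (l : F).
Hypotheses (l_ge0 : 0 <= l) (l_le1 : l <= 1).

Lemma binomial_weight_ge0 n k : 0 <= binomial_weight l n k.
Proof. by rewrite /binomial_weight !mulr_ge0 ?ler0n ?exprn_ge0 ?subr_ge0. Qed.

Lemma column_sum_binomial_weight N k :
  l * \sum_(n < N) binomial_weight l n k <= 1.
Proof.
elim: k => [|k].
  under eq_bigr => n _ do rewrite binomial_weight0.
  have -> : l * \sum_(n < N) (1 - l) ^+ n = 1 - (1 - l) ^+ N.
    by rewrite -[RHS]opprB subrX1; ring.
  by rewrite gerBl exprn_ge0 ?subr_ge0.
(* With [C k] the column sum over [n < N], adding the row [n = N] and dropping the zero row [n = 0]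
   lets Pascal's rule give [C k.+1 <= (1 - l) * C k.+1 + l * C k], that is
   [l * C k.+1 <= l * C k]. *)
apply: le_trans.
have : \sum_(n < N) binomial_weight l n k.+1 <=
       \sum_(n < N.+1) binomial_weight l n k.+1.
  by rewrite big_ord_recr /= lerDl binomial_weight_ge0.
rewrite [leRHS]big_ord_recl binomial_weight_small// add0r.
under [leRHS]eq_bigr => n _ do rewrite /= /bump /= add1n binomial_weightS.
rewrite big_split /= -!mulr_sumr.
lra.
Qed.

Lemma sum_binomial_average_le (q : nat -> F) N : (forall k, 0 <= q k) ->
  l * \sum_(n < N) \sum_(k < n.+1) binomial_weight l n k * q k <=
  \sum_(k < N) q k.
Proof.
move=> q0.
have -> : \sum_(n < N) \sum_(k < n.+1) binomial_weight l n k * q k =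
          \sum_(n < N) \sum_(k < N) binomial_weight l n k * q k.
  apply: eq_bigr => n _.
  (* Zero weights pad the triangle [k <= n] to a square, so that the sums can be exchanged. *)
  rewrite (big_ord_widen N (fun k => binomial_weight l n k * q k))//.
  rewrite [LHS]big_mkcond /=; apply: eq_bigr => k _.
  by case: ltnP => // nk; rewrite binomial_weight_small// mul0r.
rewrite exchange_big /= mulr_sumr; apply: ler_sum => k _.
by rewrite -mulr_suml mulrA ler_piMl// column_sum_binomial_weight.
Qed.

End BinomialWeightReal.

(** Applied to the embedding of [R] in [R[i]], this identifies the moduli of the complex weights
    with the real weights. *)
Lemma rmorph_binomial_weight {K L : comNzRingType} (h : {rmorphism K -> L})
    (l : K) n k :
  binomial_weight (h l) n k = h (binomial_weight l n k).
Proof.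
by rewrite /binomial_weight !rmorphM !rmorphXn rmorphB rmorph1 rmorph_nat.
Qed.

(** * The Euler operator on the square-summable sequences *)

Section EulerOperator.
Variables (R : realType) (l : R).
Local Notation normc := (@Normc.normc R).

Lemma normc_real (x : R) : 0 <= x -> normc x%:C = x.
Proof. by move=> x0; rewrite /= expr0n addr0 sqrtr_sqr ger0_norm. Qed.

Lemma normc_sum n (F : 'I_n -> R[i]) :
  normc (\sum_(i < n) F i) <= \sum_(i < n) normc (F i).
Proof.
elim/big_rec2 : _ => [|i x y _ xy]; first by rewrite Normc.normc0.
by apply: le_trans (normcD_le _ _) _; rewrite lerD2l.
Qed.

Lemma eulerE (f : nat -> R[i]) n :
  euler l%:C f n = \sum_(k < n.+1) binomial_weight l%:C n k * f k.
Proof. by []. Qed.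

Lemma eulerS (f : nat -> R[i]) n :
  euler l%:C f n.+1 =
  (1 - l%:C) * euler l%:C f n + l%:C * euler l%:C (f \o S) n.
Proof.
rewrite !eulerE sum_binomial_weightS !mulr_sumr -big_split /=.
by apply: eq_bigr => k _; ring.
Qed.

Lemma euler_linear a (f g : nat -> R[i]) n :
  euler l%:C (fun k => a * f k + g k) n =
  a * euler l%:C f n + euler l%:C g n.
Proof.
rewrite !eulerE mulr_sumr -big_split /=.
by apply: eq_bigr => k _; ring.
Qed.

Hypotheses (l_gt0 : 0 < l) (l_le1 : l <= 1).

Lemma sqr_normc_euler (f : nat -> R[i]) n :
  normc (euler l%:C f n) ^+ 2 <=
  \sum_(k < n.+1) binomial_weight l n k * normc (f k) ^+ 2.
Proof.
have w0 k : 0 <= binomial_weight l n k by rewrite binomial_weight_ge0// ltW.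
apply: le_trans (sqr_convex_sum _ (fun k : 'I_n.+1 => binomial_weight l n k)
  (fun k : 'I_n.+1 => normc (f k)) _ (sum_binomial_weight l n)) => [|//].
rewrite ler_pXn2r// ?nnegrE ?normc_ge0//; last first.
  by apply: sumr_ge0 => k _; rewrite mulr_ge0 ?normc_ge0.
rewrite eulerE; apply: le_trans (normc_sum _ _) _.
apply: ler_sum => k _.
by rewrite Normc.normcM (rmorph_binomial_weight (real_complex R)) normc_real.
Qed.

Lemma square_series_euler (f : nat -> R[i]) N :
  l * square_series (euler l%:C f) N <= square_series f N.
Proof.
rewrite /square_series /series /= !big_mkord.
apply: le_trans (sum_binomial_average_le _ _ (ltW l_gt0) l_le1
  (fun k => normc (f k) ^+ 2) _ (fun k => sqr_ge0 _)).
rewrite ler_pM2l//; apply: ler_sum => n _; exact: sqr_normc_euler.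
Qed.

(** Bounding by a square serves twice: for membership in [ell2], and for the operator norm through
    [ell2_rnorm_le]. *)
Lemma square_series_euler_le (f : ell2 R) N :
  square_series (euler l%:C f) N <= (ell2_rnorm f / Num.sqrt l) ^+ 2.
Proof.
rewrite exprMn exprVn (sqr_sqrtr (ltW l_gt0)) ler_pdivlMr// mulrC.
exact: le_trans (square_series_euler _ _) (square_series_le _ _).
Qed.

Definition euler_op (f : ell2 R) : ell2 R :=
  Ell2 (square_summable_bound (square_series_euler_le f)).

Lemma euler_op_bounded_linear : bounded_linear euler_op.
Proof.
split=> [a f g|]; first by apply: ell2_eq => n; exact: euler_linear.
exists ((Num.sqrt l)^-1)%:C => f.
rewrite !ell2_normE -rmorphM lecR mulrC; apply: ell2_rnorm_le.
  by rewrite divr_ge0 ?ell2_rnorm_ge0 ?sqrtr_ge0.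
exact: square_series_euler_le.
Qed.

Lemma euler_op_neq0 : euler_op <> (fun=> 0).
Proof.
(* The image of the basis vector [e_0] has coordinate [w 0 0 = 1] at index 0. *)
move=> /(congr1 (fun X : ell2 R -> ell2 R => X (ell2_basis R 0) 0%N)) /=.
rewrite eulerE big_ord1 binomial_weight0 expr0 mul1r /basis_seq /=.
by move/eqP; rewrite oner_eq0.
Qed.

(** By [eulerS], [E f n - E f n.+1 = l * (E f n - E (f \o S) n)], and the backward shift is
    composition with [S]. *)
Lemma euler_op_intertwines (f : ell2 R) :
  euler_op f - backward_shift (euler_op f) =
  l%:C *: euler_op (f - backward_shift f).
Proof.
apply: ell2_eq => n.
rewrite ell2DE ell2NE ell2ZE /= eulerS.
have -> : euler l%:C (f - backward_shift f) n =
          euler l%:C f n - euler l%:C (f \o S) n.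
  rewrite !eulerE -sumrB; apply: eq_bigr => k _.
  by rewrite ell2DE ell2NE /= mulrBr.
by ring.
Qed.

End EulerOperator.

(** * Boundedness of [I - S^*] and conclusion *)

Lemma backward_shift_le (R : realType) (f : ell2 R) :
  `|backward_shift f| <= `|f|.
Proof.
rewrite !ell2_normE lecR; apply: ell2_rnorm_le => [|n].
  exact: ell2_rnorm_ge0.
apply: le_trans (square_series_le f n.+1).
by rewrite square_series_shift lerDr sqr_ge0.
Qed.

Lemma id_sub_bshift_bounded_linear (R : realType) :
  bounded_linear (idfun \- @backward_shift R).
Proof.
split=> [a f g|].
  apply: ell2_eq => n.
  change (a * f n + g n - (a * f n.+1 + g n.+1) =
          a * (f n - f n.+1) + (g n - g n.+1)).
  by ring.
(* The bound 2 comes from the triangle inequality, the backward shift being a contraction. *)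
exists 2 => f; apply: le_trans (ler_normB _ _) _.
by rewrite mulr_natl mulr2n lerD2l backward_shift_le.
Qed.

Theorem proposition2p2 (R : realType) (lambda : R)
    (lambda_gt0 : 0 < lambda) (lambda_le1 : lambda <= 1) :
  extended_eigenvalue (idfun \- adjoint (@unilateral_shift R)) lambda%:C /\
  exists E : ell2 R -> ell2 R,
    (forall (f : ell2 R) (n : nat), E f n = euler lambda%:C f n) /\
    extended_eigenoperator (idfun \- adjoint (@unilateral_shift R)) lambda%:C E.
Proof.
rewrite adjoint_shift; set E := euler_op R lambda lambda_gt0 lambda_le1.
have hE : extended_eigenoperator (idfun \- @backward_shift R) lambda%:C E.
  split; [exact: euler_op_bounded_linear|exact: euler_op_neq0|].
  exact: euler_op_intertwines.
split; first by split; [exact: id_sub_bshift_bounded_linear|exists E].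
by exists E.
Qed.
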